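(* Let $h(y)$ be a delta series and $l(y)$ an invertible series over $\mathbb{C}$, and let $\{{}_sA_n(x)\}_{n\ge 0}$ be the Sheffer-Appell polynomial sequence for the pair $(l(y),h(y))$. Then for every integer $n\ge 0$, $${}_sA_{n+1}(x)=\sum_{k=0}^{n}(x a_k+b_k+c_k)\,\frac{{}_sA_n^{(k)}(x)}{k!},$$ where, for $k\ge 0$, $$a_k=\left(\frac{1}{h'(y)}\right)^{(k)}\Bigg|_{y=0},\qquad b_k=\left(-\frac{l'(h(y))}{l(h(y))}\right)^{(k)}\Bigg|_{y=0},\qquad c_k=\left(-\frac{l'(y)}{h'(y)\,l(y)}\right)^{(k)}\Bigg|_{y=0}.$$
   Context: All series are power series in $y$ over $\mathbb{C}$, of the form $\sum_{r\ge 0}\alpha_r y^r/r!$. A delta series is a power series $h(y)$ with $h(0)=0$ and $h'(0)\neq 0$; an invertible series is a power series $l(y)$ with $l(0)\neq 0$. $h^{-1}(y)$ denotes the compositional inverse of $h(y)$, i.e. $h^{-1}(h(y))=h(h^{-1}(y))=y$. The Sheffer-Appell polynomial sequence $\{{}_sA_n(x)\}_{n\ge0}$ for the pair $(l(y),h(y))$, written ${}_sA_n(x)\sim(l(y),h(y))$, is defined by the generating function $$\frac{1}{l(h^{-1}(y))\,l(y)}\,e^{x h^{-1}(y)}=\sum_{n=0}^{\infty}{}_sA_n(x)\,\frac{y^n}{n!}.$$ For a series $g(y)$, $(g(y))^{(k)}|_{y=0}$ denotes its $k$th derivative with respect to $y$ evaluated at $y=0$; $l'(h(y))$ means $l'$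 evaluated at $h(y)$. ${}_sA_n^{(k)}(x)$ is the $k$th derivative of ${}_sA_n(x)$ with respect to $x$. *)

(* Defs.v *)
From HB Require Import structures.
From mathcomp Require Import all_boot all_order all_algebra.
From mathcomp Require Import boolp reals complex.
Set Implicit Arguments.
Unset Strict Implicit.
Unset Printing Implicit Defensive.
Import GRing.Theory.
Local Open Scope ring_scope.

(* Formal power series \sum_n (f n) y^n.  The coefficients stored are the
   ordinary ones: the exponential coefficient alpha_n of y^n / n! is
   n`! * f n (see [fps_egf] for the conversion). *)
Record fps (K : Type) : Type := Fps { fps_coef : nat -> K }.
Coercion fps_coef : fps >-> Funclass.

HB.instance Definition _ (K : Type) := gen_eqMixin (fps K).
HB.instance Definition _ (K : Type) := gen_choiceMixin (fps K).

Lemma fpsP (K : Type) (f g : fps K) : (forall n, f n = g n) <-> f = g.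
Proof.
split=> [|-> //]; case: f => f; case: g => g /= fg.
by congr Fps; apply/funext.
Qed.

Section Ring.
Variable K : comNzRingType.
Implicit Types f g : fps K.

Definition fpsC (c : K) : fps K := Fps (fun n => if n == 0%N then c else 0).
Definition fpsX : fps K := Fps (fun n => (n == 1%N)%:R).

Definition fps_opp f : fps K := Fps (fun n => - f n).
Definition fps_add f g : fps K := Fps (fun n => f n + g n).
Definition fps_mul f g : fps K :=
  Fps (fun n => \sum_(i < n.+1) f i * g (n - i)%N).

Fact fps_addA : associative fps_add.
Proof. by move=> f g h; apply/fpsP => n /=; rewrite addrA. Qed.
Fact fps_addC : commutative fps_add.
Proof. by move=> f g; apply/fpsP => n /=; rewrite addrC. Qed.
Fact fps_add0 : left_id (fpsC 0) fps_add.
Proof. by move=> f; apply/fpsP => n /=; rewrite if_same add0r. Qed.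
Fact fps_addN : left_inverse (fpsC 0) fps_opp fps_add.
Proof. by move=> f; apply/fpsP => n /=; rewrite if_same addNr. Qed.

HB.instance Definition _ :=
  GRing.isZmodule.Build (fps K) fps_addA fps_addC fps_add0 fps_addN.

Fact fps_mulC : commutative fps_mul.
Proof.
move=> f g; apply/fpsP => n /=; rewrite (reindex_inj rev_ord_inj) /=.
by apply: eq_bigr => i _; rewrite subSS subKn ?leq_ord // mulrC.
Qed.

Fact fps_mul1 : left_id (fpsC 1) fps_mul.
Proof.
move=> f; apply/fpsP => n /=; rewrite big_ord_recl /= subn0 mul1r.
by rewrite big1 ?addr0 // => i _; rewrite mul0r.
Qed.

Fact fps_mulDl : left_distributive fps_mul +%R.
Proof.
move=> f g h; apply/fpsP => n /=; rewrite -big_split.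
by apply: eq_bigr => i _; rewrite /= mulrDl.
Qed.

Let fps_mul_rev f g n : fps_mul f g n = \sum_(i < n.+1) f (n - i)%N * g i.
Proof.
by rewrite fps_mulC /=; apply: eq_bigr => i _; rewrite mulrC.
Qed.

Fact fps_mulA : associative fps_mul.
Proof.
move=> p q r; apply/fpsP => i; rewrite [RHS]fps_mul_rev.
change (\sum_(j < i.+1) p j * fps_mul q r (i - j)%N =
        \sum_(k < i.+1) fps_mul p q (i - k)%N * r k).
pose coef3 j k := p j * (q (i - j - k)%N * r k).
transitivity (\sum_(j < i.+1) \sum_(k < i.+1 | (k <= i - j)%N) coef3 j k).
  apply: eq_bigr => j _; rewrite fps_mul_rev big_distrr /=.
  by rewrite (big_ord_narrow_leq (leq_subr _ _)).
rewrite (exchange_big_dep predT) //=; apply: eq_bigr => k _.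
transitivity (\sum_(j < i.+1 | (j <= i - k)%N) coef3 j k).
  apply: eq_bigl => j; rewrite -ltnS -(ltnS j) -!subSn ?leq_ord //.
  by rewrite -subn_gt0 -(subn_gt0 j) -!subnDA addnC.
rewrite (big_ord_narrow_leq (leq_subr _ _)) big_distrl /=.
by apply: eq_bigr => j _; rewrite /coef3 -!subnDA addnC mulrA.
Qed.

Fact fps_1neq0 : fpsC 1 != 0.
Proof. by apply/eqP => /fpsP/(_ 0%N)/eqP; rewrite /= oner_eq0. Qed.

HB.instance Definition _ := GRing.Zmodule_isComNzRing.Build (fps K)
  fps_mulA fps_mulC fps_mul1 fps_mulDl fps_1neq0.

Lemma coef_fps0 n : (0 : fps K) n = 0. Proof. by rewrite /= if_same. Qed.
Lemma coef_fps1 n : (1 : fps K) n = (n == 0%N)%:R.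
Proof. by rewrite /=; case: eqP. Qed.
Lemma coef_fpsD f g n : (f + g) n = f n + g n. Proof. by []. Qed.
Lemma coef_fpsN f n : (- f) n = - f n. Proof. by []. Qed.
Lemma coef_fpsM f g n : (f * g) n = \sum_(i < n.+1) f i * g (n - i)%N.
Proof. by []. Qed.

Lemma coef_fpsCM c f n : (fpsC c * f) n = c * f n.
Proof.
rewrite coef_fpsM big_ord_recl /= subn0 big1 ?addr0 // => i _.
by rewrite mul0r.
Qed.

Lemma coef_fps_sum I (r : seq I) (P : pred I) (F : I -> fps K) n :
  (\sum_(i <- r | P i) F i) n = \sum_(i <- r | P i) F i n.
Proof.
by elim/big_rec2: _ => [|i x f _ <-]; rewrite ?coef_fps0 ?coef_fpsD.
Qed.

Lemma coef_fpsX_eq0 f n m : f 0%N = 0 -> (n < m)%N -> (f ^+ m) n = 0.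
Proof.
move=> f0; elim: m n => // m IHm n lt_nm; rewrite exprS coef_fpsM.
rewrite big1 // => -[[|i] /= ltin] _; first by rewrite f0 mul0r.
by rewrite IHm ?mulr0 //; case: n lt_nm ltin => // n ltnm _;
  rewrite subSS (leq_ltn_trans (leq_subr _ _)).
Qed.

Definition fps_deriv f : fps K := Fps (fun n => f n.+1 *+ n.+1).

Definition fps_derivn_at0 (k : nat) f : K := iter k fps_deriv f 0%N.

(* f(g(y)); this truncated sum is the composition only when g 0 = 0, in which
   case (g ^+ j) n = 0 for n < j. *)
Definition fps_comp f g : fps K :=
  Fps (fun n => \sum_(j < n.+1) f j * (g ^+ j) n).

Definition fps_compinv h g : Prop := fps_comp h g = fpsX /\ fps_comp g h = fpsX.

End Ring.

Arguments fpsX {K}.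

Section UnitRing.
Variable K : comUnitRingType.
Implicit Types f g : fps K.

Definition fps_unit : pred (fps K) := [pred f : fps K | f 0%N \is a GRing.unit].

(* The geometric series c * \sum_j (1 - c f)^j for 1 / f, with c = 1 / f(0). *)
Definition fps_inv f : fps K :=
  if fps_unit f then
    Fps (fun n => (f 0%N)^-1 * \sum_(j < n.+1) ((1 - fpsC (f 0%N)^-1 * f) ^+ j) n)
  else f.

Fact fps_mulVr : {in fps_unit, left_inverse 1 fps_inv *%R}.
Proof.
move=> f uf; rewrite /fps_inv (uf : fps_unit f) mulrC.
set c := (f 0%N)^-1; set u := 1 - fpsC c * f.
have u0 : u 0%N = 0.
  by rewrite coef_fpsD coef_fpsN coef_fpsCM coef_fps1 /c mulVr ?subrr.
apply/fpsP => n.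
pose s : fps K := \sum_(j < n.+1) u ^+ j.
have -> : (f * Fps (fun m => c * \sum_(j < m.+1) (u ^+ j) m)) n =
          (f * (fpsC c * s)) n.
  rewrite !coef_fpsM; apply: eq_bigr => i _; rewrite coef_fpsCM coef_fps_sum.
  congr (_ * (_ * _)) => /=.
  rewrite (big_ord_widen n.+1 (fun j => (u ^+ j) (n - i)%N)) ?ltnS ?leq_subr //.
  rewrite [RHS](bigID (fun j : 'I_n.+1 => (j < (n - i).+1)%N)) /=.
  rewrite [X in _ = _ + X]big1 ?addr0 // => j; rewrite -leqNgt => ltj.
  exact: coef_fpsX_eq0.
have -> : f * (fpsC c * s) = 1 - u ^+ n.+1.
  have -> : 1 - u ^+ n.+1 = (1 - u) * s by rewrite -opprB subrX1 -mulNr opprB.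
  by rewrite /u opprB addrC subrK mulrA [f * _]mulrC.
by rewrite coef_fpsD coef_fpsN [X in _ - X]coef_fpsX_eq0 // subr0.
Qed.

Fact fps_unitP f g : g * f = 1 -> fps_unit f.
Proof.
move=> /fpsP/(_ 0%N); rewrite coef_fpsM coef_fps1 big_ord1 subn0 => gf.
by apply/unitrP; exists (g 0%N); rewrite [f _ * _]mulrC gf.
Qed.

Fact fps_inv_out : {in [predC fps_unit], fps_inv =1 id}.
Proof. by move=> f /negbTE uf; rewrite /fps_inv (uf : fps_unit f = false). Qed.

HB.instance Definition _ := GRing.ComNzRing_hasMulInverse.Build (fps K)
  fps_mulVr fps_unitP fps_inv_out.

(* \sum_n a_n y^n / n!.  Only meaningful when every n! is a unit of K, as for
   C and {poly C} with C of characteristic 0. *)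
Definition fps_egf (a : nat -> K) : fps K := Fps (fun n => a n / n`!%:R).

Definition fps_exp : fps K := fps_egf (fun=> 1).

End UnitRing.

Arguments fps_exp {K}.

Definition fps_map (K L : Type) (phi : K -> L) (f : fps K) : fps L :=
  Fps (fun n => phi (f n)).

Section ShefferAppell.
Variable C : numFieldType.

Definition delta_series (h : fps C) : Prop :=
  h 0%N = 0 /\ fps_derivn_at0 1%N h <> 0.

Definition invertible_series (l : fps C) : Prop := l 0%N <> 0.

(* A ~ (l, h): the generating function is an identity in C[x][[y]], with the
   indeterminate x of {poly C} written 'X and g = h^{-1}(y). *)
Definition sheffer_appell (l h : fps C) (A : nat -> {poly C}) : Prop :=
  exists g : fps C, fps_compinv h g /\
    fps_map polyC (1 / (fps_comp l g * l))
      * fps_comp fps_exp (fpsC 'X * fps_map polyC g) = fps_egf A.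

End ShefferAppell.

(* Main.v *)
(** Write [G] for the generating function of [A] and [g] for the compositional
    inverse of [h].  Multiplying [G] by [g] amounts to differentiating it with
    respect to [x], so multiplying it by [f(g(y))] amounts to applying the
    differential operator [f(d/dx)] to every [A n].  On the other hand
    [g' = 1 / h'(g)] and [l'(y) / l(y)] is [l'(h) / l(h)] evaluated at [g], so
    logarithmic differentiation in [y] gives [G' = (x a(g) + b(g) + c(g)) G]
    for the series [a], [b], [c] whose derivatives at 0 are [a_k], [b_k],
    [c_k].  It remains to compare the coefficients of [y^n]; only [k <= n]
    contribute because [g^k] starts at [y^k]. *)
Require Import Defs.
From HB Require Import structures.
From mathcomp Require Import all_boot all_order all_algebra.
From mathcomp Require Import reals complex.
From mathcomp Require Import ring.
Import GRing.Theory.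
Local Open Scope ring_scope.

(** * Derivation and composition of formal power series over a commutative ring *)

Section Composition.
Context {K : comNzRingType}.
Implicit Types f g h q : fps K.

Lemma fpsC_is_zmod_morphism : zmod_morphism (@fpsC K).
Proof. by move=> a b; apply/fpsP => n /=; case: eqP; rewrite ?subr0. Qed.

Lemma fpsC_is_monoid_morphism : monoid_morphism (@fpsC K).
Proof.
split=> // a b; apply/fpsP => n; rewrite coef_fpsCM /=.
by case: eqP; rewrite ?mulr0.
Qed.

HB.instance Definition _ :=
  GRing.isZmodMorphism.Build K (fps K) (@fpsC K) fpsC_is_zmod_morphism.
HB.instance Definition _ :=
  GRing.isMonoidMorphism.Build K (fps K) (@fpsC K) fpsC_is_monoid_morphism.

Lemma eq_coef_fpsMl f f' q n :
  (forall m, (m <= n)%N -> f m = f' m) -> (f * q) n = (f' * q) n.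
Proof.
move=> ff'; rewrite !coef_fpsM; apply: eq_bigr => i _.
by rewrite ff' // leq_ord.
Qed.

Lemma fps_derivD f g : fps_deriv (f + g) = fps_deriv f + fps_deriv g.
Proof. by apply/fpsP => n; rewrite /= mulrnDl. Qed.

Lemma fps_deriv0 : fps_deriv (0 : fps K) = 0.
Proof. by apply/fpsP => n; rewrite /= if_same mul0rn. Qed.

Lemma fps_derivC (c : K) : fps_deriv (fpsC c) = 0.
Proof. by apply/fpsP => n; rewrite /= mul0rn if_same. Qed.

Lemma fps_derivX : fps_deriv fpsX = 1 :> fps K.
Proof. by apply/fpsP => -[|n]; rewrite /= ?mul0rn. Qed.

Lemma fps_deriv_sum I (r : seq I) (P : pred I) (F : I -> fps K) :
  fps_deriv (\sum_(i <- r | P i) F i) = \sum_(i <- r | P i) fps_deriv (F i).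
Proof. by rewrite (big_morph _ fps_derivD fps_deriv0). Qed.

Lemma fps_derivM f g :
  fps_deriv (f * g) = fps_deriv f * g + f * fps_deriv g.
Proof.
apply/fpsP => n; rewrite coef_fpsD /=.
transitivity (\sum_(i < n.+2)
    ((f i * g (n.+1 - i)%N) *+ i + (f i * g (n.+1 - i)%N) *+ (n.+1 - i))).
  rewrite -sumrMnl; apply: eq_bigr => i _.
  by rewrite -mulrnDr subnKC // leq_ord.
rewrite big_split /= big_ord_recl mulr0n add0r; congr (_ + _).
  by apply: eq_bigr => i _; rewrite /= subSS mulrnAl.
rewrite big_ord_recr /= subnn mulr0n addr0; apply: eq_bigr => i _.
by rewrite subSn ?leq_ord // mulrnAr.
Qed.

Lemma fps_derivXn f n :
  fps_deriv (f ^+ n.+1) = (f ^+ n * fps_deriv f) *+ n.+1.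
Proof.
elim: n => [|n IHn]; first by rewrite expr0 mul1r.
rewrite exprS fps_derivM IHn mulrnAr mulrA -exprS [RHS]mulrS.
by rewrite mulrC.
Qed.

Lemma iter_fps_derivE k f m :
  iter k (@fps_deriv K) f m = f (m + k)%N *+ (m + k) ^_ k.
Proof.
elim: k m => [|k IHk] m; first by rewrite addn0.
by rewrite /= IHk addSn -addnS -mulrnA ffactnSr mulnC addnS subSn ?leq_addl //
  addnK mulnC.
Qed.

Lemma fps_derivn_at0E k f : fps_derivn_at0 k f = f k *+ k`!.
Proof. by rewrite /fps_derivn_at0 iter_fps_derivE ffactnn. Qed.

(** The sum defining [fps_comp] has a length that depends on the coefficient read. With a fixed
    length [N] it becomes a finite sum of series, to which ring and derivation lemmas apply. *)
Definition fps_comp_trunc N f g : fps K :=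
  \sum_(j < N) fpsC (f j) * g ^+ j.

Lemma coef_fps_comp_trunc N f g n :
  fps_comp_trunc N f g n = \sum_(j < N) f j * (g ^+ j) n.
Proof. by rewrite coef_fps_sum; apply: eq_bigr => j _; rewrite coef_fpsCM. Qed.

Lemma fps_compE N f g n : g 0%N = 0 -> (n < N)%N ->
  fps_comp f g n = fps_comp_trunc N f g n.
Proof.
move=> g0 ltnN; rewrite coef_fps_comp_trunc /=.
rewrite (big_ord_widen N (fun j => f j * (g ^+ j) n)) //.
rewrite [RHS](bigID (fun j : 'I_N => (j < n.+1)%N)) /=.
rewrite [X in _ = _ + X]big1 ?addr0 // => j; rewrite -leqNgt => ltnj.
by rewrite coef_fpsX_eq0 ?mulr0.
Qed.

Lemma coef_fps_comp0 f g : fps_comp f g 0%N = f 0%N.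
Proof. by rewrite /= big_ord1 expr0 mulr1. Qed.

Lemma eq_coef_fps_comp f f' g n :
  (forall m, (m <= n)%N -> f m = f' m) -> fps_comp f g n = fps_comp f' g n.
Proof. by move=> ff' /=; apply: eq_bigr => i _; rewrite ff' // leq_ord. Qed.

(** Since [g ^+ k] has no term below degree [k], only the powers up to [n] reach coefficient [n].
    The range of the sum in the theorem comes from here. *)
Lemma coef_fps_compM f g q n : g 0%N = 0 ->
  (fps_comp f g * q) n = \sum_(k < n.+1) f k * (g ^+ k * q) n.
Proof.
move=> g0; rewrite (@eq_coef_fpsMl _ (fps_comp_trunc n.+1 f g)); last first.
  by move=> m lemn; apply: fps_compE.
rewrite mulr_suml coef_fps_sum; apply: eq_bigr => k _.
by rewrite -mulrA coef_fpsCM.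
Qed.

Lemma fps_compX f : fps_comp f fpsX = f.
Proof.
have Xn j : fpsX ^+ j = Fps (fun n => (n == j)%:R) :> fps K.
  elim: j => [|j IHj]; apply/fpsP => n; first by rewrite expr0 coef_fps1.
  rewrite exprS IHj coef_fpsM; case: n => [|n]; first by rewrite big_ord1 mul0r.
  rewrite big_ord_recl big_ord_recl /= mul0r add0r mul1r big1 ?addr0.
    by rewrite /bump /= subSS subn0 eqSS.
  by move=> i _; rewrite mul0r.
apply/fpsP => n /=; rewrite big_ord_recr Xn /= eqxx mulr1 big1 ?add0r // => i _.
by rewrite Xn /= gtn_eqF ?mulr0.
Qed.

Lemma fps_compD f f' g : fps_comp (f + f') g = fps_comp f g + fps_comp f' g.
Proof.
apply/fpsP => n /=; rewrite -big_split; apply: eq_bigr => i _.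
by rewrite /= mulrDl.
Qed.

Lemma fps_compN f g : fps_comp (- f) g = - fps_comp f g.
Proof.
by apply/fpsP => n /=; rewrite -sumrN; apply: eq_bigr => i _; rewrite mulNr.
Qed.

Lemma fps_compC (c : K) g : fps_comp (fpsC c) g = fpsC c.
Proof.
apply/fpsP => n /=; rewrite big_ord_recl big1 ?addr0 => [|i _]; last first.
  by rewrite mul0r.
by rewrite /=; case: eqP; rewrite ?mulr1 ?mulr0.
Qed.

Lemma fps_comp0 g : fps_comp 0 g = 0.
Proof. exact: fps_compC. Qed.

Lemma fps_comp1 g : fps_comp 1 g = 1.
Proof. exact: fps_compC. Qed.

Lemma fps_comp_sum g I (r : seq I) (P : pred I) (F : I -> fps K) :
  fps_comp (\sum_(i <- r | P i) F i) g = \sum_(i <- r | P i) fps_comp (F i) g.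
Proof.
by rewrite (big_morph (fun f => fps_comp f g)
  (fun f f' : fps K => fps_compD f f' g) (fps_comp0 g)).
Qed.

(** Both sides sum [f i * f' j * (g ^+ (i + j)) n], over a triangle on the left and over a larger
    range on the right; the extra terms vanish. *)
Lemma fps_compM f f' g : g 0%N = 0 ->
  fps_comp (f * f') g = fps_comp f g * fps_comp f' g.
Proof.
move=> g0; apply/fpsP => n; rewrite coef_fps_compM //.
transitivity (\sum_(k < n.+1) \sum_(i < n.+1 | (i <= k)%N)
                f i * f' (k - i)%N * (g ^+ k) n).
  apply: eq_bigr => k _; rewrite mulr_suml.
  by rewrite (big_ord_narrow_leq (leq_ord k)).
rewrite (exchange_big_dep predT) //; apply: eq_bigr => i _.
rewrite [g ^+ i * _]mulrC coef_fps_compM // mulr_sumr.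
transitivity (\sum_(0 <= j < n.+1) f i * (f' j * (g ^+ (j + i)) n)); last first.
  by rewrite big_mkord; apply: eq_bigr => j _; rewrite -exprD.
rewrite (big_cat_nat (leq0n (n.+1 - i)) (leq_subr i n.+1)).
(* In the second range [i + j] exceeds [n], so [g ^+ (j + i)] has no term of degree [n]. *)
rewrite [X in _ = _ + X]big_nat_cond [X in _ = _ + X]big1 ?addr0; last first.
  move=> j; rewrite andbT => /andP[lej _].
  rewrite coef_fpsX_eq0 ?mulr0 // addnC -ltn_subLR ?leq_ord //.
  by rewrite -subSn ?leq_ord.
transitivity (\sum_(i <= k < n.+1) f i * f' (k - i)%N * (g ^+ k) n).
  by rewrite big_geq_mkord.
rewrite -{1}[nat_of_ord i]add0n big_addn; apply: eq_bigr => j _.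
by rewrite addnK; ring.
Qed.

Lemma fps_compXn f g n : g 0%N = 0 -> fps_comp (f ^+ n) g = fps_comp f g ^+ n.
Proof.
move=> g0; elim: n => [|n IHn]; first exact: fps_comp1.
by rewrite !exprS fps_compM // IHn.
Qed.

(** Truncating [f(h)] leaves a polynomial in [h], and composition with [g] respects sums, products
    and constants. *)
Lemma fps_compA f h g : h 0%N = 0 -> g 0%N = 0 ->
  fps_comp (fps_comp f h) g = fps_comp f (fps_comp h g).
Proof.
move=> h0 g0; apply/fpsP => n.
rewrite (@eq_coef_fps_comp _ (fps_comp_trunc n.+1 f h)); last first.
  by move=> m lemn; apply: fps_compE.
rewrite fps_comp_sum coef_fps_sum; apply: eq_bigr => j _.
by rewrite fps_compM // fps_compC coef_fpsCM fps_compXn.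
Qed.

Lemma fps_deriv_comp f g : g 0%N = 0 ->
  fps_deriv (fps_comp f g) = fps_comp (fps_deriv f) g * fps_deriv g.
Proof.
move=> g0; apply/fpsP => n.
transitivity (fps_deriv (fps_comp_trunc n.+2 f g) n).
  (* Coefficient [n] of a derivative reads coefficient [n.+1] of the series, hence the truncation at
     [n.+2]. *)
  by congr (_ *+ _); apply: fps_compE.
rewrite coef_fps_compM // fps_deriv_sum coef_fps_sum big_ord_recl.
rewrite expr0 mulr1 fps_derivC coef_fps0 add0r; apply: eq_bigr => i _.
rewrite fps_derivM fps_derivC mul0r add0r coef_fpsCM fps_derivXn.
rewrite -mulr_natl -(rmorph_nat (@fpsC K)) coef_fpsCM mulr_natl.
by rewrite mulrnAr -mulrnAl.
Qed.

End Composition.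

(** * Reciprocals of series over a field *)

Section FieldCoefficients.
Context {F : fieldType}.
Implicit Types f g h l : fps F.

Lemma fps_unitE f : (f \is a GRing.unit) = (f 0%N != 0).
Proof. by rewrite -unitfE. Qed.

Lemma fps_compV f g : g 0%N = 0 -> f \is a GRing.unit ->
  fps_comp f^-1 g = (fps_comp f g)^-1.
Proof.
move=> g0 uf; have ug : fps_comp f g \is a GRing.unit.
  by rewrite fps_unitE coef_fps_comp0 -fps_unitE.
apply: (mulrI ug); rewrite mulrV // -fps_compM // mulrV //; exact: fps_comp1.
Qed.

(** Differentiate [f / f = 1]. The right-hand side isolates the logarithmic derivative of [f^-1]. *)
Lemma fps_derivV f : f \is a GRing.unit ->
  fps_deriv f^-1 = - (fps_deriv f / f) * f^-1.
Proof.
move=> uf; apply: (mulrI uf); apply/eqP.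
rewrite -subr_eq0 !mulNr mulrN opprK mulrCA mulrV // mulr1; apply/eqP.
have := congr1 (@fps_deriv F) (mulrV uf).
by rewrite fps_derivM fps_derivC addrC mulrC.
Qed.

End FieldCoefficients.

(** * Ring morphisms applied coefficientwise *)

Section Map.
Context {K L : comNzRingType} (phi : {rmorphism K -> L}).
Implicit Types f g : fps K.

Lemma fps_map_is_zmod_morphism : zmod_morphism (fps_map phi).
Proof. by move=> f g; apply/fpsP => n; rewrite /= rmorphB. Qed.

Lemma fps_map_is_monoid_morphism : monoid_morphism (fps_map phi).
Proof.
split=> [|f g]; apply/fpsP => n.
  by rewrite coef_fps1 -(rmorph_nat phi) -coef_fps1.
rewrite /= rmorph_sum; apply: eq_bigr => i _; exact: rmorphM.
Qed.

HB.instance Definition _ := GRing.isZmodMorphism.Build (fps K) (fps L)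
  (fps_map phi) fps_map_is_zmod_morphism.
HB.instance Definition _ := GRing.isMonoidMorphism.Build (fps K) (fps L)
  (fps_map phi) fps_map_is_monoid_morphism.

Lemma fps_map_comp f g :
  fps_map phi (fps_comp f g) = fps_comp (fps_map phi f) (fps_map phi g).
Proof.
apply/fpsP => n; rewrite /= rmorph_sum; apply: eq_bigr => j _.
by rewrite -rmorphXn rmorphM.
Qed.

Lemma fps_deriv_map f : fps_deriv (fps_map phi f) = fps_map phi (fps_deriv f).
Proof. by apply/fpsP => n; rewrite /= rmorphMn. Qed.

End Map.

(** * Series over C[x] and differentiation in x *)

Section PolynomialCoefficients.
Context {C : numFieldType}.
Implicit Types (f g : fps C) (G : fps {poly C}).

(** [{poly C}] is not a field, so cancelling the factorials of [fps_egf] requires them to be units;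
    they are nonzero constants in characteristic 0. *)
Lemma natrS_poly_unit n : n.+1%:R \is a @GRing.unit {poly C}.
Proof. by rewrite -polyC_natr rmorph_unit // unitfE Num.Theory.pnatr_eq0. Qed.

Lemma fact_poly_unit n : n`!%:R \is a @GRing.unit {poly C}.
Proof. by case: n`! (fact_gt0 n) => // m _; apply: natrS_poly_unit. Qed.

Lemma fps_deriv_egf (a : nat -> {poly C}) :
  fps_deriv (fps_egf a) = fps_egf (fun n => a n.+1).
Proof.
apply/fpsP => n; rewrite /= -[LHS]mulr_natr -mulrA; congr (_ * _).
rewrite factS natrM invrM ?natrS_poly_unit ?fact_poly_unit //.
by rewrite divrK // natrS_poly_unit.
Qed.

(* The derivative with respect to the indeterminate of the coefficients. *)
Local Notation Dx := (fps_map (@deriv C)).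

Lemma Dx_mulC f G : Dx (fps_map polyC f * G) = fps_map polyC f * Dx G.
Proof.
apply/fpsP => n; rewrite /= raddf_sum; apply: eq_bigr => i _.
by rewrite /= derivM derivC mul0r add0r.
Qed.

(** Termwise, the x-derivative of [x^j g^j / j!] is [g] times the preceding term of the
    exponential. *)
Lemma Dx_exp g : g 0%N = 0 ->
  Dx (fps_comp fps_exp (fpsC 'X * fps_map polyC g)) =
  fps_map polyC g * fps_comp fps_exp (fpsC 'X * fps_map polyC g).
Proof.
move=> g0; set gx := fps_map polyC g; set e := fps_exp.
have gx0 : (fpsC 'X * gx) 0%N = 0 by rewrite coef_fpsCM /= g0 mulr0.
have e_coef j : e j = ((j`!%:R)^-1)%:P by rewrite /= mul1r -polyCV -polyC_natr.
have pow_coef j n : ((fpsC 'X * gx) ^+ j) n = 'X ^+ j * ((g ^+ j) n)%:P.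
  by rewrite exprMn -rmorphXn coef_fpsCM -rmorphXn.
apply/fpsP => n; rewrite [gx * _]mulrC coef_fps_compM //.
(* One term more than coefficient [n] needs: the term [j = 0] is constant in x and drops out, and
   the remaining [n.+1] terms match the right-hand side. *)
transitivity ((fps_comp_trunc n.+2 e (fpsC 'X * gx) n)^`()).
  by congr (deriv _); apply: fps_compE.
rewrite coef_fps_comp_trunc (big_morph _ (@derivD C) (deriv0 C)).
rewrite big_ord_recl pow_coef.
rewrite e_coef expr0 mul1r -polyCM derivC add0r; apply: eq_bigr => j _.
rewrite pow_coef derivM {1}e_coef derivC mul0r add0r derivM derivC mulr0 addr0.
have -> : (fpsC 'X * gx) ^+ j * gx = fpsC 'X^j * fps_map polyC (g ^+ j.+1).
  by rewrite exprMn exprSr rmorphM /= !rmorphXn mulrA.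
(* As exp is its own derivative, [e j] is [e j.+1 *+ j.+1], which supplies the factor produced by
   differentiating ['X^j.+1]. *)
have <- : fps_deriv e j = e j by rewrite fps_deriv_egf.
by rewrite derivXn coef_fpsCM /= !(mulrnAl, mulrnAr).
Qed.

(** By hypothesis multiplication by [g] acts as d/dx on the generating function, so [g ^+ k] acts as
    the [k]-th derivative and [f(g)] as [f(d/dx)]. *)
Lemma coef_comp_mul_egf f g (A : nat -> {poly C}) n : g 0%N = 0 ->
  Dx (fps_egf A) = fps_map polyC g * fps_egf A ->
  n`!%:R * (fps_map polyC (fps_comp f g) * fps_egf A) n =
  \sum_(0 <= k < n.+1) (f k)%:P * (A n)^`(k).
Proof.
move=> g0 DxA.
have derivnA k : n`!%:R * (fps_map polyC g ^+ k * fps_egf A) n = (A n)^`(k).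
  elim: k => [|k IHk].
    by rewrite expr0 mul1r /= mulrC divrK ?fact_poly_unit.
  rewrite derivnS -IHk -polyC_natr derivM derivC mul0r add0r; congr (_ * _).
  by rewrite exprSr -mulrA -DxA -rmorphXn -Dx_mulC.
rewrite fps_map_comp coef_fps_compM /= ?g0 // big_mkord mulr_sumr.
by apply: eq_bigr => k _; rewrite mulrCA derivnA.
Qed.

End PolynomialCoefficients.

(** * Logarithmic derivative of the Sheffer-Appell generating function *)

Section ShefferAppell.
Context {C : numFieldType} (h l g : fps C).
Hypotheses (h_delta : delta_series h) (l_inv : invertible_series l).
Hypothesis hg : fps_compinv h g.

(** The constant coefficient of [fps_comp g h] is [g 0] by definition, so this can be read off
    before any composition law is available for [g]. *)
Lemma compinv0 : g 0%N = 0.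
Proof.
by have /fpsP/(_ 0%N) := hg.2; rewrite coef_fps_comp0.
Qed.

Lemma invertible_series_unit : l \is a GRing.unit.
Proof. by rewrite fps_unitE; apply/eqP. Qed.

Lemma delta_deriv_unit : fps_deriv h \is a GRing.unit.
Proof. by rewrite fps_unitE; apply/eqP => h1; case: h_delta => _; apply. Qed.

(** Chain rule applied to [h(g(y)) = y]. *)
Lemma fps_deriv_compinv : fps_deriv g = fps_comp (1 / fps_deriv h) g.
Proof.
have g0 := compinv0; rewrite div1r fps_compV ?delta_deriv_unit //.
have hgE : fps_comp (fps_deriv h) g * fps_deriv g = 1.
  by rewrite -fps_deriv_comp // hg.1 fps_derivX.
have u : fps_comp (fps_deriv h) g \is a GRing.unit.
  by rewrite fps_unitE coef_fps_comp0 -fps_unitE delta_deriv_unit.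
by apply: (mulrI u); rewrite hgE mulrV.
Qed.

(** The exponential contributes [x g'], and the factors [1 / l] and [1 / l(g)] contribute the other
    two terms. All three are written as composites with [g], the form that [coef_comp_mul_egf]
    takes. *)
Lemma fps_deriv_sheffer_appell_gf :
  let G := fps_map polyC (1 / (fps_comp l g * l))
             * fps_comp fps_exp (fpsC 'X * fps_map polyC g) in
  fps_deriv G =
  fpsC 'X * (fps_map polyC (fps_comp (1 / fps_deriv h) g) * G)
  + fps_map polyC
      (fps_comp (- (fps_comp (fps_deriv l) h / fps_comp l h)) g) * G
  + fps_map polyC
      (fps_comp (- (fps_deriv l / (fps_deriv h * l))) g) * G.
Proof.
have [h0 _] := h_delta; have g0 := compinv0.
have lu := invertible_series_unit; have hu := delta_deriv_unit.
have comp_unit f k :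
    f \is a GRing.unit -> fps_comp f k \is a @GRing.unit (fps C).
  by rewrite !fps_unitE coef_fps_comp0.
(* Composing with [g] cancels [h]; in [cE] it turns [1 / h'] into [g']. *)
have bE : fps_comp (- (fps_comp (fps_deriv l) h / fps_comp l h)) g
          = - (fps_deriv l / l).
  rewrite fps_compN fps_compM // fps_compV ?comp_unit //.
  by rewrite !fps_compA // hg.1 !fps_compX.
have cE : fps_comp (- (fps_deriv l / (fps_deriv h * l))) g
          = - (fps_comp (fps_deriv l) g * fps_deriv g / fps_comp l g).
  rewrite fps_compN fps_compM // invrM // fps_compM // fps_compV //.
  by rewrite -div1r [in RHS]fps_deriv_compinv !div1r mulrA mulrAC.
rewrite bE cE -fps_deriv_compinv.
set u := 1 / _; set E := fps_comp fps_exp _; cbv zeta.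
have uE : fps_deriv u =
    (- (fps_deriv l / l)
     - fps_comp (fps_deriv l) g * fps_deriv g / fps_comp l g) * u.
  rewrite /u div1r fps_derivV ?unitrM ?comp_unit // fps_derivM.
  congr (_ * _); rewrite invrM ?comp_unit // fps_deriv_comp //.
  set lg := fps_comp l g; have lgV : lg / lg = 1 by rewrite mulrV ?comp_unit.
  have lV : l / l = 1 by rewrite mulrV.
  rewrite -opprD mulrDl addrC; congr (- (_ + _)).
    by rewrite mulrC mulrA -[l^-1 * _]mulrC; ring: lgV.
  by ring: lV.
have EE : fps_deriv E = fpsC 'X * fps_map polyC (fps_deriv g) * E.
  rewrite fps_deriv_comp ?coef_fpsCM /= ?g0 ?mulr0 //.
  rewrite fps_deriv_egf fps_derivM fps_derivC mul0r add0r fps_deriv_map.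
  exact: mulrC.
rewrite fps_derivM EE fps_deriv_map uE rmorphM rmorphB /= rmorphN.
by ring.
Qed.

End ShefferAppell.

Theorem theorem2 (R : realType) (h l : fps R[i]) (A : nat -> {poly R[i]})
    (h_delta : delta_series h) (l_inv : invertible_series l)
    (hA : sheffer_appell l h A) (n : nat) :
  let a (k : nat) := fps_derivn_at0 k (1 / fps_deriv h) in
  let b (k : nat) :=
    fps_derivn_at0 k (- (fps_comp (fps_deriv l) h / fps_comp l h)) in
  let c (k : nat) :=
    fps_derivn_at0 k (- (fps_deriv l / (fps_deriv h * l))) in
  A n.+1 = \sum_(0 <= k < n.+1)
    (k`!%:R)^-1 *: (('X * (a k)%:P + (b k)%:P + (c k)%:P) * (A n)^`(k)).
Proof.
case: hA => g [hg hG]; have g0 := compinv0 h g hg.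
have DxA : fps_map deriv (fps_egf A) = fps_map polyC g * fps_egf A.
  by rewrite -hG Dx_mulC Dx_exp // mulrCA.
move=> a b c.
(* Differentiating in y shifts the sequence, and [n!] clears the denominator of [fps_egf]. *)
have -> : A n.+1 = n`!%:R * fps_deriv (fps_egf A) n.
  by rewrite fps_deriv_egf /= mulrC divrK ?fact_poly_unit.
rewrite -hG (fps_deriv_sheffer_appell_gf h l g h_delta l_inv hg) hG.
rewrite !coef_fpsD coef_fpsCM !mulrDr mulrCA !coef_comp_mul_egf // mulr_sumr.
rewrite -!big_split; apply: eq_bigr => k _.
(* The operator lemma yields ordinary coefficients; passing to derivatives at 0 produces the factor
   [1 / k!]. *)
have coefE (f : fps R[i]) : (f k)%:P = (k`!%:R^-1)%:P * (fps_derivn_at0 k f)%:P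
    :> {poly R[i]}.
  rewrite -rmorphM fps_derivn_at0E -[f k *+ _]mulr_natl mulKf //.
  by rewrite Num.Theory.pnatr_eq0 -lt0n fact_gt0.
by rewrite !coefE -mul_polyC -/(a k) -/(b k) -/(c k) /=; ring.
Qed.
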